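(* Let $\theta\in\,]0,1[$ be fixed and, for $n\in\mathbb{N}$, let $m=\lfloor\theta n\rfloor$ (with $m\ge1$). Then for every $1\le p\le\infty$ there is a constant $\mathcal{C}_p>0$ depending only on $p$ such that, for every function $f$ defined on $[-1,1]$, $$\|\tilde S_n^mf\|_p\le\mathcal{C}_p\|f\|_{\ell^p(X_n)}.$$ Moreover, for every $f\in C^0([-1,1])$, $\tilde S_n^mf\to f$ uniformly on $[-1,1]$ as $n\to\infty$, and $$E_{n+m-1}(f)_\infty\le\|\tilde S_n^mf-f\|_\infty\le\mathcal{C}\,E_{n-m}(f)_\infty$$ with $\mathcal{C}>0$ independent of $f,n,m$.
   Context: Let $w(x)=(1-x^2)^{-1/2}$ on $[-1,1]$, $\|f\|_\infty=\sup_{|x|\le1}|f(x)|$, $\|f\|_p=(\int_{-1}^1|f|^pw\,dx)^{1/p}$ for $1\le p<\infty$, and $E_N(f)_\infty=\inf_{P\in\mathbb{P}_N}\|f-P\|_\infty$ with $\mathbb{P}_N$ the polynomials of degree at most $N$. Chebyshev nodes: $X_n=\{x_k^n=\cos\frac{(2k-1)\pi}{2n}: k=1,\ldots,n\}$; discrete norms $\|f\|_{\ell^\infty(X_n)}=\max_k|f(x_k^n)|$ and $\|f\|_{\ell^p(X_n)}=(\frac{\pi}{n}\sum_{k=1}^n|f(x_k^n)|^p)^{1/p}$ for $1\le p<\infty$. The orthonormal Chebyshev polynomials are $p_0=\sqrt{1/\pi}$, $p_r(x)=\sqrt{2/\pi}\cos(r\arccos x)$, $r\ge1$. For $0<m<n$: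 $\mu_{n,r}^m=1$ if $0\le r\le n-m$, $\frac{m+n-r}{2m}$ if $n-m<r<n+m$, $0$ otherwise; for $r=0,\ldots,n-1$, $q_{n,r}^m=p_r$ if $r\le n-m$ and $q_{n,r}^m=\mu_{n,r}^mp_r-\mu_{n,2n-r}^mp_{2n-r}$ if $n-m<r<n$; $\nu_{n,r}^m=1$ if $r\le n-m$, $\frac{m^2+(n-r)^2}{2m^2}$ if $n-m<r<n$. Orthonormal VP scaling functions: $\tilde\varphi_{n,k}^m=\sum_{r=0}^{n-1}\sqrt{\frac{\pi}{n\nu_{n,r}^m}}p_r(x_k^n)q_{n,r}^m$, $k=1,\ldots,n$. The discrete projection is $\tilde S_n^mf(x)=\sum_{k=1}^n\Big[\frac{\pi}{n}\sum_{i=1}^nf(x_i^n)\tilde\varphi_{n,k}^m(x_i^n)\Big]\tilde\varphi_{n,k}^m(x)$. *)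

(* Defs.v *)
From HB Require Import structures.
From mathcomp Require Import all_boot all_order all_algebra.
From mathcomp Require Import all_classical all_reals all_analysis.
Set Implicit Arguments. Unset Strict Implicit. Unset Printing Implicit Defensive.
Import Order.TTheory GRing.Theory Num.Theory.
Import numFieldNormedType.Exports.
Local Open Scope classical_set_scope.
Local Open Scope ring_scope.

Section Defs.
Variable R : realType.

(* Chebyshev weight w(x) = (1-x^2)^(-1/2) (value 0 at x = +-1 by the
   convention 0^-1 = 0; a null set, irrelevant for the integral). *)
Definition chebw (x : R) : R := (Num.sqrt (1 - x ^+ 2))^-1.

(* Chebyshev nodes x_k^n = cos((2k-1)pi/(2n)), k = 1..n; indexed by i : 'I_n
   with k = i+1. *)
Definition node (n : nat) (i : nat) : R :=
  cos ((2 * i + 1)%:R * pi / (2 * n)%:R).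

Definition supnorm (g : R -> R) : R := sup [set `|g x| | x in `[-1, 1]%classic].

Definition normp (p : \bar R) (g : R -> R) : R :=
  match p with
  | EFin r => (fine (\int[lebesgue_measure]_(x in `[-1, 1]%classic)
                 ((`|g x| `^ r) * chebw x)%:E)) `^ r^-1
  | _ => supnorm g
  end.

Definition dnormp (p : \bar R) (n : nat) (g : R -> R) : R :=
  match p with
  | EFin r => (pi / n%:R * \sum_(i < n) `|g (node n i)| `^ r) `^ r^-1
  | _ => \big[Num.max/0]_(i < n) `|g (node n i)|
  end.

Definition EN (N : nat) (f : R -> R) : R :=
  inf [set supnorm (fun x => f x - P.[x]) | P in [set P : {poly R} | (size P <= N.+1)%N]].

Definition cheb (r : nat) (x : R) : R :=
  if r == 0%N then Num.sqrt (1 / pi) else Num.sqrt (2 / pi) * cos (r%:R * acos x).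

Definition mu (n m r : nat) : R :=
  if (r <= n - m)%N then 1
  else if (r < n + m)%N then (m + n - r)%:R / (2 * m)%:R else 0.

Definition qf (n m r : nat) (x : R) : R :=
  if (r <= n - m)%N then cheb r x
  else mu n m r * cheb r x - mu n m (2 * n - r) * cheb (2 * n - r) x.

Definition nu (n m r : nat) : R :=
  if (r <= n - m)%N then 1 else ((m ^ 2 + (n - r) ^ 2)%:R) / (2 * m ^ 2)%:R.

(* orthonormal VP scaling functions ~phi_{n,k}^m, k = i+1 *)
Definition phit (n m : nat) (i : nat) (x : R) : R :=
  \sum_(r < n) Num.sqrt (pi / (n%:R * nu n m r)) * cheb r (node n i) * qf n m r x.

Definition Sdisc (n m : nat) (f : R -> R) (x : R) : R :=
  \sum_(k < n) (pi / n%:R * \sum_(i < n) f (node n i) * phit n m k (node n i))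
                * phit n m k x.

End Defs.

(* Main.v *)
Require Import Defs.
From HB Require Import structures.
From mathcomp Require Import all_boot all_order all_algebra.
From mathcomp Require Import all_classical all_reals all_analysis.
From mathcomp Require Import measurable_realfun.
From mathcomp Require Import ring lra zify.
Set Implicit Arguments. Unset Strict Implicit. Unset Printing Implicit Defensive.
Import Order.TTheory GRing.Theory Num.Theory.
Import numFieldNormedType.Exports.
Local Open Scope classical_set_scope.
Local Open Scope ring_scope.

(** With [x = cos t] and [x_i = cos t_i], discrete orthogonality and the
    reflection [p_(2n-r)(x_i) = - p_r(x_i)] turn the projection into
    [S f (x) = pi/n sum_i f(x_i) sum_(l < 2n) c_l p_l(x_i) p_l(x)], where
    [c_l = h((l - n)/m)] and [h] is the continuous function equal to [1] on
    [u <= -1], to [(1 - u)/(1 + u^2)] on [-1 <= u <= 1] and to [0] on [1 <= u].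
    Summing twice by parts writes the kernel as a combination of the Fejer
    kernels [fker] with the second differences of [c] as coefficients.  A Fejer
    kernel is nonnegative, and both its discrete mean over the nodes and its
    integral against the weight equal its number of terms; hence the kernel is
    bounded by a nonnegative majorant whose two marginals are at most
    [sum_r (r + 1) |D^2 c_r| = O((n/m)^2)], and Jensen's inequality yields the
    bound for every [p].  Since [S] fixes the polynomials of degree [<= n - m],
    the sup-norm bound gives the error estimate, and the uniform convergence
    follows from Weierstrass' theorem, which the positive discrete Fejer means
    give because their second moment about [x] is [1/n]. *)

(** * Double summation by parts *)

Lemma sum_by_parts (R : comPzRingType) (c g : nat -> R) N :
  \sum_(l < N) c l * g l =
  c N * (\sum_(l < N) g l) +
  \sum_(l < N) (c l - c l.+1) * (\sum_(j < l.+1) g j).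
Proof.
elim: N => [|N IH]; first by rewrite !big_ord0 mulr0 addr0.
rewrite big_ord_recr [in X in _ + X]big_ord_recr /= IH.
rewrite [X in c N.+1 * X](_ : _ = \sum_(j < N.+1) g j) //.
rewrite [\sum_(j < N.+1) g j]big_ord_recr /=.
set S := \sum_(j < N) _; set T := \sum_(l < N) (_ * _).
by ring.
Qed.

(** Two vanishing multipliers at the end kill both boundary terms, leaving only second differences
    against double partial sums. *)
Lemma sum_by_parts2 (R : comPzRingType) (c g : nat -> R) N :
  c N = 0 -> c N.+1 = 0 ->
  \sum_(l < N) c l * g l =
  \sum_(r < N) (c r - c r.+1 *+ 2 + c r.+2) *
    (\sum_(j < r.+1) \sum_(l < j.+1) g l).
Proof.
move=> c0 c1; rewrite sum_by_parts c0 mul0r add0r.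
rewrite (sum_by_parts (fun l => c l - c l.+1) (fun l => \sum_(j < l.+1) g j)).
rewrite c0 c1 subr0 mul0r add0r; apply: eq_bigr => r _; congr (_ * _).
by ring.
Qed.

(** * Chebyshev nodes and Fejer kernels *)

Section Trig.
Variable R : realType.
Implicit Types (s t u x : R) (n r l : nat).

Definition ang n i : R := (2 * i + 1)%:R * pi / (2 * n)%:R.

Lemma nodeE n i : node R n i = cos (ang n i). Proof. by []. Qed.

Lemma ang_itv n i : (i < n)%N -> 0 <= ang n i <= pi.
Proof.
move=> lt_in; have n0 : 0 < (2 * n)%:R :> R by rewrite ltr0n; lia.
rewrite /ang divr_ge0 ?mulr_ge0 ?pi_ge0 //= ler_pdivrMr // mulrC.
by rewrite ler_pM2l ?pi_gt0 // ler_nat; lia.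
Qed.

Lemma sin_natmul_pi k : sin (k%:R * pi) = 0 :> R.
Proof.
elim: k => [|k IH]; first by rewrite mul0r sin0.
by rewrite -natr1 mulrDl mul1r sinDpi IH oppr0.
Qed.

(** With a = l pi / (2n), the product 2 sin a cos(l t_i) telescopes and the total is sin(2na) =
    sin(l pi) = 0; the range of l puts a in ]0, pi[, so sin a > 0. *)
Lemma sum_cos_ang n l : (0 < l < 2 * n)%N ->
  \sum_(i < n) cos (l%:R * ang n i) = 0.
Proof.
move=> /andP[l0 ln]; set a : R := l%:R * pi / (2 * n)%:R.
have n0 : 0 < (2 * n)%:R :> R by rewrite ltr0n; lia.
have sa : 0 < sin a.
  apply: sin_gt0_pi; rewrite divr_gt0 ?mulr_gt0 ?pi_gt0 ?ltr0n //=; last lia.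
  by rewrite ltr_pdivrMr // mulrC ltr_pM2l ?pi_gt0 // ltr_nat.
have key k : (sin a *+ 2) * \sum_(i < k) cos (l%:R * ang n i)
    = sin ((2 * k)%:R * a).
  elim: k => [|k IH]; first by rewrite big_ord0 mulr0 muln0 mul0r sin0.
  rewrite big_ord_recr /= mulrDr IH.
  have -> : l%:R * ang n k = (2 * k)%:R * a + a.
    rewrite /ang /a natrD; field; rewrite pnatr_eq0; lia.
  have -> : (2 * k.+1)%:R * a = ((2 * k)%:R * a + a) + a.
    by rewrite mulnS natrD; ring.
  set b := (2 * k)%:R * a; have -> : sin b = sin ((b + a) - a) by congr sin; ring.
  by rewrite sinB (sinD (b + a)); ring.
have := key n; have -> : (2 * n)%:R * a = l%:R * pi.
  by rewrite /a mulrC divfK // lt0r_neq0.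
rewrite sin_natmul_pi => /eqP; rewrite mulf_eq0 => /orP[|/eqP //].
by rewrite mulrn_eq0 /= (negbTE (lt0r_neq0 sa)).
Qed.

(** The orthonormal Chebyshev polynomials in the angle variable, defined for every real [t] so that
    trigonometric identities apply without range conditions. *)
Definition cb r t : R :=
  if r == 0%N then Num.sqrt (1 / pi) else Num.sqrt (2 / pi) * cos (r%:R * t).

Lemma chebE r x : cheb r x = cb r (acos x). Proof. by []. Qed.

Lemma cheb_cos r t : 0 <= t <= pi -> cheb r (cos t) = cb r t.
Proof. by move=> ht; rewrite chebE cosK // in_itv. Qed.

Lemma cheb_node r n i : (i < n)%N -> cheb r (node R n i) = cb r (ang n i).
Proof. by move=> ?; rewrite nodeE cheb_cos // ang_itv. Qed.

Lemma cbM0 s t : cb 0 s * cb 0 t = pi^-1.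
Proof. by rewrite /cb /= -expr2 sqr_sqrtr ?mul1r // invr_ge0 pi_ge0. Qed.

Lemma cbMS l s t :
  cb l.+1 s * cb l.+1 t =
  pi^-1 * (cos (l.+1%:R * (s - t)) + cos (l.+1%:R * (s + t))).
Proof.
rewrite /cb /= mulrACA -expr2 sqr_sqrtr; last by rewrite divr_ge0 ?pi_ge0.
rewrite (mulrBr _ s t) (mulrDr _ s t) cosB cosD; ring.
Qed.

(** The unnormalised Fejer kernel: the sum of the first r Dirichlet kernels. *)
Definition fejer r u : R :=
  \sum_(j < r) (2^-1 + \sum_(l < j) cos (l.+1%:R * u)).

(** This is half the squared modulus of Z = sum of exp(iau) over a < r. Adding z = exp(iru)
    increases it by Re(Z conj z) + 1/2, which is the next Dirichlet kernel. *)
Lemma fejerE r u : fejer r u =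
  ((\sum_(a < r) cos (a%:R * u)) ^+ 2 + (\sum_(a < r) sin (a%:R * u)) ^+ 2) / 2.
Proof.
elim: r => [|r IH]; first by rewrite /fejer !big_ord0 expr0n /=; ring.
rewrite /fejer big_ord_recr -/(fejer r u) IH /= !(big_ord_recr r) /=.
set C := \sum_(i < r) cos _; set S := \sum_(i < r) sin _.
set c := cos (r%:R * u); set s := sin _.
(* Reversing the index turns the sum into that of cos((r - a)u), which the subtraction formula
   expands. *)
have -> : \sum_(l < r) cos (l.+1%:R * u) = C * c + S * s.
  rewrite [LHS](reindex_inj rev_ord_inj) /= !mulr_suml -big_split /=.
  apply: eq_bigr => i _.
  transitivity (cos (r%:R * u - i%:R * u)); last by rewrite cosB /c /s; ring.
  congr cos; rewrite -mulrBl -natrB; last by have := ltn_ord i; lia.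
  by congr (_%:R * _); have := ltn_ord i; lia.
have h : 2^-1 = (c ^+ 2 + s ^+ 2) / 2 :> R by rewrite cos2Dsin2 mul1r.
by rewrite [X in _ + (X + _)]h; field.
Qed.

Lemma fejer_ge0 r u : 0 <= fejer r u.
Proof. by rewrite fejerE divr_ge0 // addr_ge0 // sqr_ge0. Qed.

(** The double partial sums that two summations by parts produce from the products p_l(cos s)
    p_l(cos t). *)
Definition fker r s t : R :=
  \sum_(j < r) \sum_(l < j.+1) cb l s * cb l t.

Lemma fkerE r s t : fker r s t = pi^-1 * (fejer r (s - t) + fejer r (s + t)).
Proof.
rewrite /fker /fejer -big_split /= mulr_sumr; apply: eq_bigr => j _.
rewrite big_ord_recl cbM0 addrACA -big_split /=.
(* The degree 0 term 1/pi supplies the constant 1/2 of both Dirichlet kernels. *)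
rewrite (_ : 2^-1 + 2^-1 = 1); last by field.
rewrite mulrDr mulr1 mulr_sumr; congr (_ + _); apply: eq_bigr => i _.
by rewrite cbMS.
Qed.

Lemma fker_ge0 r s t : 0 <= fker r s t.
Proof.
by rewrite fkerE mulr_ge0 ?invr_ge0 ?pi_ge0 // addr_ge0 ?fejer_ge0.
Qed.

Lemma sum_cb_ang n l : (0 < l < 2 * n)%N -> \sum_(i < n) cb l (ang n i) = 0.
Proof.
case: l => // l hl.
by rewrite /cb /= -mulr_sumr sum_cos_ang ?mulr0.
Qed.

(** All degrees involved are below 2n, so the node sums kill every l > 0; each of the r inner sums
    keeps its degree 0 term and contributes 1. *)
Lemma sum_fker_node n r t : (0 < n)%N -> (r <= 2 * n)%N ->
  pi / n%:R * (\sum_(i < n) fker r (ang n i) t) = r%:R.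
Proof.
move=> n0 hr; rewrite /fker exchange_big /= mulr_sumr.
rewrite (eq_bigr (fun=> 1)) => [|j _]; last first.
  rewrite exchange_big big_ord_recl /= [X in _ + X]big1 ?addr0 => [|l _]; last first.
    rewrite /= -mulr_suml sum_cb_ang ?mul0r // /bump /=.
    by have := ltn_ord l; have := ltn_ord j; lia.
  under eq_bigr do rewrite cbM0.
  rewrite sumr_const card_ord -[_ *+ n]mulr_natr.
  have := lt0r_neq0 (pi_gt0 R); move: pi => p p0.
  by field; rewrite p0 pnatr_eq0 -lt0n n0.
by rewrite sumr_const card_ord.
Qed.

(** Products become cosines of frequencies |r - s| and r + s, both below 2n, whose node sums vanish
    unless the frequency is 0. *)
Lemma cb_orth n r (s : nat) : (r < n)%N -> (s < n)%N ->
  pi / n%:R * (\sum_(i < n) cb r (ang n i) * cb s (ang n i)) = (r == s)%:R.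
Proof.
move=> rn sn; have n0 : (0 < n)%N by lia.
have nn : n%:R != 0 :> R by rewrite pnatr_eq0; lia.
have pp : pi != 0 :> R by rewrite lt0r_neq0 // pi_gt0.
have aux a b : (a < b < n)%N -> \sum_(i < n) cb a (ang n i) * cb b (ang n i) = 0.
  case: a => [|a] /andP[ab bn].
    by rewrite /cb eqxx -mulr_sumr sum_cb_ang ?mulr0 //; lia.
  case: b ab bn => // b ab bn.
  rewrite /cb /= (eq_bigr (fun i : 'I_n => pi^-1 *
     (cos ((b - a)%:R * ang n i) + cos ((a.+1 + b.+1)%:R * ang n i)))) => [|i _].
    by rewrite -mulr_sumr big_split /= !sum_cos_ang ?addr0 ?mulr0 //; lia.
  rewrite mulrACA -expr2 sqr_sqrtr; last by rewrite divr_ge0 ?pi_ge0.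
  have -> : (b - a)%:R * ang n i = b.+1%:R * ang n i - a.+1%:R * ang n i.
    by rewrite -mulrBl -natrB; [rewrite subSS|lia].
  rewrite (natrD _ a.+1 b.+1) (mulrDl a.+1%:R) cosB cosD; ring.
have [ab|ab|<-] := ltngtP r s.
- by rewrite aux ?mulr0 //; lia.
- under eq_bigr do rewrite mulrC.
  by rewrite aux ?mulr0 //; lia.
case: r rn => [|r] rn.
  under eq_bigr do rewrite cbM0.
  rewrite /= mulr1n sumr_const card_ord -[_ *+ n]mulr_natr.
  by move: pi pp => p p0; field; rewrite p0 nn.
under eq_bigr do rewrite cbMS subrr mulr0 cos0.
rewrite mulr1n -mulr_sumr big_split /= sumr_const card_ord.
rewrite (eq_bigr (fun i : 'I_n => cos ((r.+1 + r.+1)%:R * ang n i))) => [|i _].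
  rewrite sum_cos_ang ?addr0; [|lia].
  by rewrite -[_ *+ n]mulr_natr; move: pi pp => p p0; field; rewrite p0 nn.
by congr cos; rewrite natrD; ring.
Qed.

End Trig.

(** * The Chebyshev weight and the substitution x = cos t *)

Section Integral.
Variable R : realType.
Implicit Types (x a b : R) (h U : R -> R).
Notation mu := (@lebesgue_measure R).

Lemma chebw_continuous x : -1 < x < 1 -> {for x, continuous (@chebw R)}.
Proof.
move=> hx; rewrite /chebw; apply: cvgV.
  by rewrite sqrtr_eq0 -ltNge; nra.
apply: (@continuous_comp _ _ _ (fun x : R => 1 - x ^+ 2) (@Num.sqrt R)).
  by apply: cvgB; [exact: cvg_cst|exact: exprn_continuous].
exact: sqrt_continuous.
Qed.

Lemma acos_weight_continuous h x : continuous h -> -1 < x < 1 ->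
  {for x, continuous (fun x => h (acos x) * chebw x)}.
Proof.
move=> ch hx; apply: cvgM; last exact: chebw_continuous.
by apply: (continuous_comp (continuous_acos hx)); exact: ch.
Qed.

Lemma measurable_acos_weight h : continuous h ->
  measurable_fun (`]-1, 1[%classic : set R) (fun x => h (acos x) * chebw x).
Proof.
move=> ch; apply: open_continuous_measurable_fun => // x.
by rewrite inE /= in_itv /= => hx; exact: acos_weight_continuous.
Qed.

(** Since acos' = -w inside ]-1, 1[, the function -U(acos x) is a primitive of the integrand. *)
Lemma integral_acos_weight_seg h U a b :
  (forall t : R, is_derive t 1 U (h t)) -> continuous h -> -1 < a -> a < b -> b < 1 ->
  (\int[mu]_(x in `[a, b]) (h (acos x) * chebw x)%:E =
   (U (acos a) - U (acos b))%:E)%E.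
Proof.
move=> dU ch a1 ab b1.
pose F x := - U (acos x).
have dF x : -1 < x < 1 -> is_derive x 1 F (h (acos x) * chebw x).
  move=> hx; have /(is_derive1_comp (dU (acos x))) dc := is_derive1_acos hx.
  have := is_deriveN dc; rewrite mulrN opprK; exact.
have cF : {within `[a, b], continuous F}.
  apply: derivable_within_continuous => x; rewrite in_itv /= => /andP[ax xb].
  have hx : -1 < x < 1 by rewrite (lt_le_trans a1 ax) (le_lt_trans xb b1).
  by have [] := dF x hx.
rewrite (@continuous_FTC2 _ _ F) //.
- by rewrite -EFinB /F opprK addrC.
- apply: continuous_in_subspaceT => x; rewrite inE /= in_itv /= => /andP[ax xb].
  by apply: acos_weight_continuous; rewrite ?(lt_le_trans a1 ax) ?(le_lt_trans xb b1).
- have /continuous_within_itvP := cF => /(_ ab) [_ Fa Fb].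
  split=> // x; rewrite in_itv /= => /andP[ax xb].
  have hx : -1 < x < 1 by rewrite (lt_trans a1 ax) (lt_trans xb b1).
  by have [] := dF x hx.
- move=> x; rewrite in_itv /= => /andP[ax xb].
  have hx : -1 < x < 1 by rewrite (lt_trans a1 ax) (lt_trans xb b1).
  by rewrite derive1E; have [_ ->] := dF x hx.
Qed.

(** The weight is singular at both ends, so ]-1, 1[ is exhausted by closed segments and monotone
    convergence applies; [U] is nondecreasing because h >= 0, which bounds each segment's
    integral. *)
Lemma integral_acos_weight_le h U :
  (forall t : R, is_derive t 1 U (h t)) -> continuous h -> (forall t, 0 <= h t) ->
  (\int[mu]_(x in `[(-1)%R, 1%R]) (h (acos x) * chebw x)%:E <= (U pi - U 0)%:E)%E.
Proof.
move=> dU ch h0.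
have Umono a b : a <= b -> U a <= U b.
  move=> ab; apply: (@ger0_derive1_ndecr _ U a b) => //.
  - by move=> x _; rewrite derive1E; have [_ ->] := dU x.
  - by apply: derivable_within_continuous => x _; have [] := dU x.
rewrite integral_itv_bndoo; last first.
  by apply/measurable_EFinP; exact: measurable_acos_weight.
(* Margins of the exhausting segments [-1 + d_k, 1 - d_k]; the bound 1/2 keeps every segment
   nonempty. *)
have [d [d0 d1 dS de]] : exists d : nat -> R, [/\ forall k, 0 < d k,
    forall k, d k <= 2^-1, forall k, d k.+1 <= d k &
    forall e, 0 < e -> exists k, d k < e].
  exists (fun k => k.+2%:R^-1); split => [k|k|k|e e0].
  - by rewrite invr_gt0 ltr0n.
  - by rewrite lef_pV2 ?posrE ?ltr0n // ler_nat.
  - by rewrite lef_pV2 ?posrE ?ltr0n // ler_nat.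
  have /cvgrPdist_lt /(_ _ e0) [k _ /(_ k.+1 (leqnSn _))] := @cvg_harmonic R.
  by rewrite /= sub0r normrN gtr0_norm ?invr_gt0 // => ?; exists k.
pose F k : set R := `[-1 + d k, 1 - d k]%classic.
have sF k : F k `<=` `]-1, 1[%classic.
  move=> x; rewrite /F /= !in_itv /= => /andP[? ?]; have ? := d0 k.
  by apply/andP; split; lra.
have -> : `]-1, 1[%classic = \bigcup_k F k.
  apply/seteqP; split => [x|x [k _ /sF //]].
  rewrite /= in_itv /= => /andP[x1 x2].
  have e0 : 0 < Num.min (x + 1) (1 - x) by rewrite lt_min; apply/andP; split; lra.
  have [k] := de _ e0; rewrite lt_min => /andP[? ?].
  by exists k => //; rewrite /F /= in_itv /=; apply/andP; split; lra.
have nF : nondecreasing_seq F.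
  apply/nondecreasing_seqP => k; rewrite subsetEset => x; rewrite /F /= !in_itv /=.
  by have := dS k; move=> ? /andP[? ?]; apply/andP; split; lra.
have mF k : measurable_fun (F k) (EFin \o (fun x => h (acos x) * chebw x)).
  apply/measurable_EFinP; apply: measurable_funS (sF k) _ => //.
  exact: measurable_acos_weight.
have cv : (\int[mu]_(x in F k) (h (acos x) * chebw x)%:E)%E @[k --> \oo] -->
    (\int[mu]_(x in \bigcup_k F k) (h (acos x) * chebw x)%:E)%E.
  apply: ge0_nondecreasing_set_cvg_integral => //; first by move=> k; exact: measurable_itv.
  by move=> k x _; rewrite lee_fin mulr_ge0 // invr_ge0 sqrtr_ge0.
rewrite -(cvg_lim _ cv) //.
apply: lime_le; first by apply/cvg_ex; eexists; exact: cv.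
apply: nearW => k; have ? := d0 k; have ? := d1 k.
have [da db dc] : [/\ -1 < -1 + d k, -1 + d k <= 1 - d k & 1 - d k < 1] by split; lra.
have [e1|dab] := eqVneq (-1 + d k) (1 - d k).
  by rewrite /F e1 set_itv1 integral_set1 lee_fin subr_ge0 Umono ?pi_ge0.
rewrite (integral_acos_weight_seg dU) //; last by rewrite lt_neqAle dab.
by rewrite lee_fin lerB // Umono // ?acos_ge0 ?acos_lepi //; apply/andP; split; lra.
Qed.

End Integral.

(** * Multipliers of the discrete projection *)

Section Coef.
Variable R : realType.
Implicit Types (s t u v d x : R) (n m r l : nat).

(** With u = (r - n)/m one has mu = (1 - u)/2 and nu = (1 + u^2)/2 on the transition range; this is
    their quotient. *)
Definition vph u : R := (1 - u) / (1 + u ^+ 2).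

Lemma vphB u v : vph v - vph u =
  (u - v) * (1 + u + v - u * v) / ((1 + u ^+ 2) * (1 + v ^+ 2)).
Proof.
have h x : 1 + x ^+ 2 != 0 by apply: lt0r_neq0; nra.
by rewrite /vph; field; rewrite !h.
Qed.

(** The explicit factor d^2 takes the place of a bound on the second derivative; the denominator is
    at least 1. *)
Lemma vph_diff2 v d : vph (v - d) - vph v *+ 2 + vph (v + d) =
  d ^+ 2 * (((1 + v) * (v *+ 2) - (1 - v) * (1 - (v - d) * (v + d))) * 2) /
  ((1 + (v - d) ^+ 2) * (1 + v ^+ 2) * (1 + (v + d) ^+ 2)).
Proof.
have h x : 1 + x ^+ 2 != 0 by apply: lt0r_neq0; nra.
by rewrite /vph; field; rewrite !h.
Qed.

Lemma ler_norm_div (a b c : R) : 1 <= b -> `|a| <= c -> `|a / b| <= c.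
Proof.
move=> b1 ac; rewrite normrM normfV (ger0_norm (le_trans ler01 b1)).
by rewrite ler_pdivrMr ?(lt_le_trans ltr01 b1) //; have := normr_ge0 a; nra.
Qed.

Lemma vph_lip u v : -1 <= u <= 1 -> -1 <= v <= 1 ->
  `|vph v - vph u| <= `|v - u| * 4.
Proof.
move=> /andP[u1 u2] /andP[v1 v2]; rewrite vphB; apply: ler_norm_div; first by nra.
have p1 : 0 <= (1 - u) * (1 - v) by apply: mulr_ge0; lra.
have p2 : 0 <= (1 - u) * (1 + v) by apply: mulr_ge0; lra.
rewrite normrM distrC; apply: ler_wpM2l => //; rewrite ler_norml; apply/andP; split; lra.
Qed.

Lemma vph_diff2_le v d : -1 <= v - d <= 1 -> -1 <= v <= 1 -> -1 <= v + d <= 1 ->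
  `|vph (v - d) - vph v *+ 2 + vph (v + d)| <= d ^+ 2 * 16.
Proof.
move=> hu hv hw; rewrite vph_diff2; apply: ler_norm_div.
  by rewrite !mulr_ege1 // lerDl sqr_ge0.
rewrite normrM (ger0_norm (sqr_ge0 d)); apply: ler_wpM2l; first exact: sqr_ge0.
rewrite normrM (ger0_norm (ler0n _ 2)) (_ : 16 = 8 * 2); last by ring.
apply: ler_wpM2r => //.
have p1 : `|(1 - v) * (1 - (v - d) * (v + d))| <= 2 * 2.
  rewrite normrM; apply: ler_pM => //; rewrite ler_norml; nra.
have p2 : `|(1 + v) * (v *+ 2)| <= 2 * 2.
  rewrite normrM; apply: ler_pM => //; rewrite ler_norml; lra.
by rewrite (le_trans (ler_normB _ _)) //; lra.
Qed.

(* The multipliers of the kernel of the discrete projection: [mu / nu] on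
   [r < n], reflected about [n] with the same [nu]. *)
Definition vpc n m r : R :=
  if (r <= n - m)%N then 1
  else if (r < n + m)%N then vph ((r%:R - n%:R) / m%:R) else 0.

(** [vph] equals 1 at -1 and 0 at 1, so the formula also covers both ends of the transition
    range. *)
Lemma vpcE n m r : (0 < m < n)%N -> (n - m <= r <= n + m)%N ->
  vpc n m r = vph ((r%:R - n%:R) / m%:R).
Proof.
move=> /andP[m0 mn] /andP[r1 r2]; rewrite /vpc.
have mm : m%:R != 0 :> R by rewrite pnatr_eq0; lia.
case: ifPn => h1.
  have -> : r = (n - m)%N by lia.
  rewrite natrB 1?ltnW // (_ : _ / _ = -1); last by field.
  by rewrite /vph; field.
case: ifPn => h2 //.
have -> : r = (n + m)%N by lia.
by rewrite natrD (_ : _ / _ = 1) /vph ?subrr ?mul0r //; field.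
Qed.

Definition vpc2 n m r : R := vpc n m r - vpc n m r.+1 *+ 2 + vpc n m r.+2.

(** The profile is smooth at scale m, giving O(1/m^2), except when the centre r + 1 is a corner n -
    m or n + m; there only the Lipschitz bound O(1/m) is available. *)
Lemma vpc2_le n m r : (0 < m < n)%N ->
  `|vpc2 n m r| <= m%:R^-1 ^+ 2 * 16 +
    m%:R^-1 * 4 * ((r.+1 == n - m)%N%:R + (r.+1 == n + m)%N%:R).
Proof.
move=> hmn; have /andP[m0 mn] := hmn.
have mm : 0 < m%:R :> R by rewrite ltr0n.
have mm0 := lt0r_neq0 mm.
have a0 : 0 <= m%:R^-1 ^+ 2 * 16 :> R by rewrite mulr_ge0 ?sqr_ge0.
have b0 (b c : bool) : 0 <= m%:R^-1 * 4 * (b%:R + c%:R) :> R.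
  by rewrite mulr_ge0 ?addr_ge0 ?mulr_ge0 ?invr_ge0 ?ler0n.
have itv l : (n - m <= l <= n + m)%N -> (-1 : R) <= ((l%:R : R) - n%:R) / m%:R <= (1 : R).
  move=> /andP[l1 l2]; rewrite ler_pdivlMr // ler_pdivrMr // mulN1r mul1r.
  have : (n - m)%:R <= l%:R :> R by rewrite ler_nat.
  rewrite natrB 1?ltnW // => ?.
  have : l%:R <= (n + m)%:R :> R by rewrite ler_nat.
  by rewrite natrD => ?; apply/andP; split; lra.
have step l : ((l.+1)%:R - n%:R) / m%:R = (l%:R - n%:R) / m%:R + m%:R^-1 :> R.
  by rewrite -natr1; field.
have lip l : (n - m <= l < n + m)%N -> `|vpc n m l.+1 - vpc n m l| <= m%:R^-1 * 4.
  move=> hl; rewrite !vpcE ?hmn //; [|lia..].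
  apply: le_trans (vph_lip (itv _ _) (itv _ _)) _; [lia..|].
  by rewrite step addrAC subrr add0r gtr0_norm ?invr_gt0.
rewrite /vpc2; have [h1|h1] := leqP r.+2 (n - m).
  rewrite /vpc !ifT; try lia.
  by rewrite mulr2n opprD addrA subrr sub0r addrC subrr normr0 addr_ge0.
have [h2|h2] := leqP (n + m) r.
  rewrite /vpc !(ifF, ifN); try lia.
  by rewrite mul0rn subrr addr0 normr0 addr_ge0.
(* At a corner one neighbour has the same multiplier as the centre, so the second difference is a
   single first difference. *)
case: eqVneq => [e1|e1] /=.
  have {1}-> : vpc n m r = vpc n m r.+1 by rewrite /vpc !ifT //; lia.
  rewrite mulr2n opprD addrA subrr sub0r addrC.
  apply: le_trans (lip _ _) _; first lia.
  by rewrite mulr1n [X in _ + X]mulrDr mulr1 addrCA lerDl addr_ge0 //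
    !mulr_ge0 ?invr_ge0 ?ler0n.
case: eqVneq => [e2|e2] /=.
  have -> : vpc n m r.+2 = 0 by rewrite /vpc !(ifF, ifN) //; lia.
  have e3 : vpc n m r.+1 = 0 by rewrite /vpc !(ifF, ifN) //; lia.
  rewrite e3 mul0rn subr0 addr0 -normrN -sub0r -e3 add0r mulr1.
  by apply: le_trans (lip _ _) _; [lia|rewrite lerDr].
(* All three indices now lie in the transition range, with step d = 1/m around the centre r + 1. *)
rewrite addr0 mulr0 addr0 !vpcE ?hmn //; try lia.
have i1 := itv r.+1 _; have i2 := itv r.+2 _; have i0 := itv r _.
have -> : (r%:R - n%:R) / m%:R = (r.+1%:R - n%:R) / m%:R - m%:R^-1 :> R.
  by rewrite step addrK.
rewrite (step r.+1); apply: vph_diff2_le.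
- by rewrite step addrK i0 //; lia.
- by apply: i1; lia.
- by rewrite -step; apply: i2; lia.
Qed.

(** The common value of the two marginals of the kernel majorant, hence a bound for the operator
    norm. *)
Definition vplam n m : R := \sum_(r < 2 * n) `|vpc2 n m r| * r.+1%:R.

(** Each weight r + 1 is at most 2n: the 2n smooth terms give 2n * 2n * 16/m^2, the two corners 2 *
    2n * 4/m. *)
Lemma vplam_le n m : (0 < m < n)%N ->
  vplam n m <= (n%:R / m%:R) ^+ 2 * 64 + (n%:R / m%:R) * 16.
Proof.
move=> hmn; have /andP[m0 mn] := hmn.
have mm : m%:R != 0 :> R by rewrite pnatr_eq0; lia.
pose B r : R := m%:R^-1 ^+ 2 * 16 +
    m%:R^-1 * 4 * ((r == (n - m).-1)%N%:R + (r == (n + m).-1)%N%:R).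
apply: (@le_trans _ _ (\sum_(r < 2 * n) B r * (2 * n)%:R)).
  apply: ler_sum => r _; apply: ler_pM => //; last by rewrite ler_nat.
  have := vpc2_le r hmn; rewrite /B.
  have -> : (r.+1 == n - m)%N = (nat_of_ord r == (n - m).-1)%N by lia.
  by have -> : (r.+1 == n + m)%N = (nat_of_ord r == (n + m).-1)%N by lia.
have delta (k : nat) : (k < 2 * n)%N -> \sum_(r < 2 * n) (nat_of_ord r == k)%N%:R = 1 :> R.
  move=> hk; rewrite (bigD1 (Ordinal hk)) //= eqxx big1 ?addr0 // => r.
  by rewrite -val_eqE /= => /negbTE ->.
rewrite -mulr_suml /B big_split /= sumr_const card_ord -mulr_sumr big_split /=.
rewrite !delta; try lia.
by rewrite -mulr_natr natrM le_eqVlt; apply/orP; left; apply/eqP; field.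
Qed.

Lemma vpc_mu_nu n m r : (0 < m < n)%N -> (r < n)%N ->
  mu R n m r / nu R n m r = vpc n m r.
Proof.
move=> /andP[m0 mn] rn; rewrite /mu /nu /vpc; case: ifPn => h1; first by rewrite divr1.
have -> : (r < n + m)%N by lia.
have mm : m%:R != 0 :> R by rewrite pnatr_eq0; lia.
have dbl (x : R) : x != 0 -> x *+ 2 != 0 by rewrite mulrn_eq0.
have d0 : m%:R ^+ 2 + (r%:R - n%:R) ^+ 2 != 0 :> R.
  by apply: lt0r_neq0; rewrite ltr_pwDl ?sqr_ge0 // exprn_gt0 // ltr0n.
rewrite /vph natrB ?natrD; [|lia]; rewrite !(natrM, natrX, natrD) natrB 1?ltnW //.
by field; rewrite mm d0 -!mulr2n !dbl // expf_neq0.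
Qed.

(** [nu] depends on r through (n - r)^2, so it takes the same value at the reflected index. *)
Lemma vpc_refl n m r : (0 < m < n)%N -> (n - m < r < n)%N ->
  mu R n m (2 * n - r) / nu R n m r = vpc n m (2 * n - r).
Proof.
move=> /andP[m0 mn] /andP[r1 r2]; rewrite /mu /nu /vpc.
have -> : (2 * n - r <= n - m)%N = false by lia.
have -> : (r <= n - m)%N = false by lia.
have -> : (2 * n - r < n + m)%N by lia.
have mm : m%:R != 0 :> R by rewrite pnatr_eq0; lia.
have dbl (x : R) : x != 0 -> x *+ 2 != 0 by rewrite mulrn_eq0.
have d0 : m%:R ^+ 2 + (r%:R - n%:R) ^+ 2 != 0 :> R.
  by apply: lt0r_neq0; rewrite ltr_pwDl ?sqr_ge0 // exprn_gt0 // ltr0n.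
have -> : (m + n - (2 * n - r) = m + r - n)%N by lia.
rewrite /vph !natrB ?natrD; try lia.
rewrite !(natrM, natrX, natrD) natrB 1?ltnW //.
have e : (n%:R + n%:R - r%:R - n%:R) ^+ 2 = (r%:R - n%:R) ^+ 2 :> R by ring.
by field; rewrite mm e d0 -!mulr2n !dbl // expf_neq0.
Qed.

Lemma vpc_eq0 n m r : (0 < m < n)%N -> (n + m <= r)%N -> vpc n m r = 0.
Proof. by move=> *; rewrite /vpc !(ifF, ifN) //; lia. Qed.

Lemma mu_refl n m r : (0 < m < n)%N -> (n - m < r < n)%N ->
  mu R n m r + mu R n m (2 * n - r) = 1.
Proof.
move=> /andP[m0 mn] /andP[r1 r2]; rewrite /mu.
have -> : (2 * n - r <= n - m)%N = false by lia.
have -> : (r <= n - m)%N = false by lia.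
have -> : (2 * n - r < n + m)%N by lia.
have -> : (r < n + m)%N by lia.
rewrite -mulrDl -natrD.
have -> : (m + n - r + (m + n - (2 * n - r)) = 2 * m)%N by lia.
by apply: divff; rewrite pnatr_eq0; lia.
Qed.

Lemma nu_gt0 n m r : (0 < m)%N -> 0 < nu R n m r.
Proof.
move=> m0; rewrite /nu; case: ifP => // _.
by rewrite divr_gt0 // ltr0n; nia.
Qed.

End Coef.

(** * The kernel of the discrete projection *)

Section Proj.
Variable R : realType.
Implicit Types (s t u x : R) (n m r l : nat) (f : R -> R).

Lemma cos_natmul_pi k : cos (k%:R * pi) = (-1) ^+ k :> R.
Proof.
elim: k => [|k IH]; first by rewrite mul0r cos0 expr0.
by rewrite -natr1 mulrDl mul1r cosDpi IH exprS mulN1r.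
Qed.

(** 2n t_i is an odd multiple of pi, so its cosine is -1 and its sine 0. *)
Lemma cb_ang_refl n r i : (0 < r < 2 * n)%N ->
  cb (2 * n - r) (ang R n i) = - cb r (ang R n i).
Proof.
move=> /andP[r0 rn]; rewrite /cb !ifN; try lia.
rewrite natrB 1?ltnW // mulrBl cosB.
have -> : (2 * n)%:R * ang R n i = (2 * i + 1)%:R * pi.
  by rewrite /ang mulrC divfK // pnatr_eq0; lia.
rewrite cos_natmul_pi sin_natmul_pi mul0r addr0 -signr_odd oddD oddM /= expr1.
by rewrite mulN1r mulrN.
Qed.

(** Degree n is the fixed point of the reflection, so the value equals its own opposite. *)
Lemma cb_ang_n n i : (0 < n)%N -> cb n (ang R n i) = 0.
Proof.
move=> n0; have := @cb_ang_refl n n i; rewrite mul2n -addnn addnK => h.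
have /eqP := h ltac:(lia); rewrite -addr_eq0 -mulr2n mulrn_eq0 /=.
by move/eqP.
Qed.

(** At a node the reflection changes the minus sign of the second term into a plus, and the two [mu]
    add up to 1. *)
Lemma qf_node n m r i : (0 < m < n)%N -> (r < n)%N -> (i < n)%N ->
  qf n m r (node R n i) = cb r (ang R n i).
Proof.
move=> hmn rn hi; rewrite /qf !cheb_node //; case: ifPn => // h.
by rewrite cb_ang_refl ?mulrN ?opprK -?mulrDl ?mu_refl ?mul1r //; lia.
Qed.

(** Discrete orthogonality collapses the double sum over degrees to its diagonal, and the squared
    normalisation leaves 1/nu. *)
Lemma sum_phit n m x y : (0 < m < n)%N ->
  \sum_(k < n) phit n m k y * phit n m k x =
  \sum_(r < n) qf n m r y * qf n m r x / nu R n m r.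
Proof.
move=> /andP[m0 mn].
have nn : n%:R != 0 :> R by rewrite pnatr_eq0; lia.
have pp : pi != 0 :> R by rewrite lt0r_neq0 // pi_gt0.
pose a r (z : R) := Num.sqrt (pi / (n%:R * nu R n m r)) * qf n m r z.
have phE k z : (k < n)%N -> phit n m k z = \sum_(r < n) a r z * cb r (ang R n k).
  move=> hk; apply: eq_bigr => r _; rewrite cheb_node // /a; ring.
rewrite (eq_bigr (fun k : 'I_n => \sum_(r < n) \sum_(q < n)
   (a r y * a q x) * (cb r (ang R n k) * cb q (ang R n k)))) => [|k _]; last first.
  rewrite !phE // mulr_suml; apply: eq_bigr => r _.
  by rewrite mulr_sumr; apply: eq_bigr => q _; rewrite mulrACA.
rewrite exchange_big; apply: eq_bigr => r _ /=.
rewrite exchange_big /= (eq_bigr (fun q : 'I_n =>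
    (a r y * a q x) * (n%:R / pi * (nat_of_ord r == q)%:R))) => [|q _]; last first.
  rewrite -mulr_sumr; congr (_ * _); rewrite -(cb_orth R (ltn_ord r) (ltn_ord q)).
  rewrite mulrA (_ : n%:R / pi * (pi / n%:R) = 1) ?mul1r //.
  by move: pi pp => p p0; field; rewrite nn p0.
rewrite (bigD1 r) //= eqxx mulr1 big1 ?addr0 => [|q qr]; last first.
  by rewrite eq_sym val_eqE (negbTE qr) !mulr0.
have nu0 := nu_gt0 R n r m0.
rewrite /a [X in X * _]mulrACA -(expr2 (Num.sqrt _)) sqr_sqrtr; last first.
  by rewrite divr_ge0 ?pi_ge0 ?mulr_ge0 ?ler0n ?ltW.
by move: pi pp => p p0; field; rewrite p0 nn lt0r_neq0.
Qed.

Lemma SdiscE n m f x : (0 < m < n)%N ->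
  Sdisc n m f x = \sum_(r < n)
    (pi / n%:R * \sum_(i < n) f (node R n i) * cb r (ang R n i)) *
    (qf n m r x / nu R n m r).
Proof.
move=> hmn; rewrite /Sdisc.
transitivity (pi / n%:R * \sum_(i < n) f (node R n i) *
    \sum_(k < n) phit n m k (node R n i) * phit n m k x).
  under eq_bigr do rewrite -mulrA mulr_suml.
  rewrite -mulr_sumr exchange_big; congr (_ * _); apply: eq_bigr => i _ /=.
  by rewrite mulr_sumr; apply: eq_bigr => k _; rewrite mulrA.
under [RHS]eq_bigr do rewrite -mulrA mulr_suml.
rewrite -[RHS]mulr_sumr exchange_big; congr (_ * _); apply: eq_bigr => i _ /=.
rewrite sum_phit // mulr_sumr; apply: eq_bigr => r _.
by rewrite qf_node // !mulrA.
Qed.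

Definition vpker n m s t : R :=
  \sum_(l < 2 * n) vpc R n m l * (cb l s * cb l t).

(** The degrees l < n come from the first terms of the [qf]; the degrees l = 2n - r come from the
    second terms, with p_r(x_i) replaced by -p_(2n-r)(x_i). *)
Lemma vpkerE n m i x : (0 < m < n)%N -> (i < n)%N ->
  \sum_(r < n) cb r (ang R n i) * (qf n m r x / nu R n m r) =
  vpker n m (ang R n i) (acos x).
Proof.
move=> hmn hi; have /andP[m0 mn] := hmn; set s := ang R n i; set t := acos x.
pose g l := vpc R n m l * (cb l s * cb l t).
have -> : vpker n m s t = \sum_(r < n) g r + \sum_(r < n) g (n + r)%N.
  by rewrite /vpker mul2n -addnn big_split_ord.
have -> : \sum_(r < n) g (n + r)%N = \sum_(r < n) g (2 * n - r)%N.
  (* The range n..2n-1 may be replaced by n+1..2n: the term l = n vanishes because p_n is 0 at the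
     nodes, the term l = 2n because its multiplier is 0. *)
  have shift : \sum_(r < n) g (n + r)%N = \sum_(r < n) g (n + r.+1)%N.
    have := erefl (\sum_(r < n.+1) g (n + r)%N).
    rewrite {1}big_ord_recr big_ord_recl /= addn0.
    have -> : g n = 0 by rewrite /g cb_ang_n ?mul0r ?mulr0 //; lia.
    have -> : g (n + n)%N = 0 by rewrite /g vpc_eq0 ?mul0r //; lia.
    by rewrite addr0 add0r.
  rewrite shift (reindex_inj rev_ord_inj) /=; apply: eq_bigr => r _; congr g.
  by have := ltn_ord r; lia.
rewrite -big_split /=; apply: eq_bigr => r _.
have rn := ltn_ord r; rewrite /qf !chebE; case: ifPn => h.
  by rewrite /g [vpc R n m (_ - _)]vpc_eq0 // ?mul0r ?addr0 /nu /vpc;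
    [rewrite h divr1 mul1r|lia].
have h' : (n - m < r < n)%N by lia.
rewrite /g -(vpc_refl R hmn h') -(vpc_mu_nu R hmn rn) cb_ang_refl; last lia.
by rewrite -/t -/s; ring.
Qed.

Lemma Sdisc_kernel n m f x : (0 < m < n)%N ->
  Sdisc n m f x =
  pi / n%:R * \sum_(i < n) f (node R n i) * vpker n m (ang R n i) (acos x).
Proof.
move=> hmn; rewrite SdiscE //.
under eq_bigr do rewrite -mulrA mulr_suml.
rewrite -mulr_sumr exchange_big; congr (_ * _); apply: eq_bigr => i _ /=.
rewrite -vpkerE // mulr_sumr; apply: eq_bigr => r _.
by rewrite !mulrA.
Qed.

(** Absolute values are put on the second differences only, so that both marginals remain
    explicit. *)
Definition vpmaj n m s t : R :=
  \sum_(r < 2 * n) `|vpc2 R n m r| * fker r.+1 s t.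

Lemma vpmaj_ge0 n m s t : 0 <= vpmaj n m s t.
Proof. by apply: sumr_ge0 => r _; rewrite mulr_ge0 // fker_ge0. Qed.

Lemma vpker_le n m s t : (0 < m < n)%N -> `|vpker n m s t| <= vpmaj n m s t.
Proof.
move=> hmn; rewrite /vpker (@sum_by_parts2 _ (vpc R n m) (fun l => cb l s * cb l t));
  [|by apply: vpc_eq0 => //; lia..].
apply: le_trans (ler_norm_sum _ _ _) _; apply: ler_sum => r _.
by rewrite normrM (ger0_norm (fker_ge0 _ _ _)).
Qed.

Lemma sum_vpmaj n m t : (0 < n)%N ->
  pi / n%:R * (\sum_(i < n) vpmaj n m (ang R n i) t) = vplam R n m.
Proof.
move=> n0; rewrite /vpmaj exchange_big /= mulr_sumr; apply: eq_bigr => r _.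
by rewrite -mulr_sumr mulrCA sum_fker_node.
Qed.

Lemma Sdisc_norm_le n m f x : (0 < m < n)%N ->
  `|Sdisc n m f x| <=
  pi / n%:R * \sum_(i < n) `|f (node R n i)| * vpmaj n m (ang R n i) (acos x).
Proof.
move=> hmn; rewrite Sdisc_kernel // normrM ger0_norm ?divr_ge0 ?pi_ge0 //.
rewrite ler_wpM2l ?divr_ge0 ?pi_ge0 //.
apply: le_trans (ler_norm_sum _ _ _) _; apply: ler_sum => i _.
by rewrite normrM ler_wpM2l // vpker_le.
Qed.

Lemma Sdisc_sup_le n m f x (M : R) : (0 < m < n)%N ->
  (forall i, (i < n)%N -> `|f (node R n i)| <= M) ->
  `|Sdisc n m f x| <= vplam R n m * M.
Proof.
move=> hmn hf; apply: le_trans (Sdisc_norm_le _ _ hmn) _.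
rewrite -(sum_vpmaj m (acos x)) -?mulrA; last lia.
rewrite !ler_wpM2l ?invr_ge0 ?pi_ge0 // mulr_suml; apply: ler_sum => i _.
by rewrite mulrC ler_wpM2l ?vpmaj_ge0 // hf.
Qed.

Lemma SdiscB n m f g x :
  Sdisc n m (fun y => f y - g y) x = Sdisc n m f x - Sdisc n m g x.
Proof.
rewrite /Sdisc -sumrB; apply: eq_bigr => k _; rewrite -mulrBl -mulrBr -sumrB.
by congr (_ * _ * _); apply: eq_bigr => i _; rewrite mulrBl.
Qed.

(** * Cosine sums and algebraic polynomials in cos t *)

Definition cospan N (g : R -> R) :=
  exists a : nat -> R, forall t, g t = \sum_(l < N.+1) a l * cb l t.

Lemma eq_cospan N g h : g =1 h -> cospan N g -> cospan N h.
Proof. by move=> e [a ha]; exists a => t; rewrite -e. Qed.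

Lemma cospanD N g h : cospan N g -> cospan N h -> cospan N (fun t => g t + h t).
Proof.
move=> [a ha] [b hb]; exists (fun l => a l + b l) => t.
by rewrite ha hb -big_split; apply: eq_bigr => l _; rewrite mulrDl.
Qed.

Lemma cospanZ N c g : cospan N g -> cospan N (fun t => c * g t).
Proof.
move=> [a ha]; exists (fun l => c * a l) => t.
by rewrite ha mulr_sumr; apply: eq_bigr => l _; rewrite mulrA.
Qed.

Lemma cospan_sum N k (g : nat -> R -> R) :
  (forall l, (l < k)%N -> cospan N (g l)) ->
  cospan N (fun t => \sum_(l < k) g l t).
Proof.
elim: k => [|k IH] hg.
  by exists (fun=> 0) => t; rewrite big_ord0 big1 // => l _; rewrite mul0r.
have h := cospanD (IH (fun l hl => hg l (ltnW hl))) (hg k (ltnSn k)).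
by apply: eq_cospan h => t; rewrite big_ord_recr.
Qed.

Lemma cospan_cb N l : (l <= N)%N -> cospan N (cb l : R -> R).
Proof.
move=> lN; exists (fun k => (k == l)%:R) => t.
rewrite (bigD1 (Ordinal (lN : (l < N.+1)%N))) //= eqxx mul1r big1 ?addr0 // => k.
by rewrite -val_eqE /= => /negbTE ->; rewrite mul0r.
Qed.

Lemma cospan_cos N l : (l <= N)%N -> cospan N (fun t => cos (l%:R * t)).
Proof.
move=> lN; case: l lN => [|l] lN.
  apply: eq_cospan (cospanZ (Num.sqrt (1 / pi))^-1 (cospan_cb lN)) => t.
  by rewrite /cb /= mul0r cos0 mulVf // sqrtr_eq0 -ltNge divr_gt0 ?pi_gt0.
apply: eq_cospan (cospanZ (Num.sqrt (2 / pi))^-1 (cospan_cb lN)) => t.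
by rewrite /cb /= mulKf // sqrtr_eq0 -ltNge divr_gt0 ?pi_gt0.
Qed.

(** Rests on 2 cos t cos(lt) = cos((l-1)t) + cos((l+1)t); degree 0 is apart because of its
    normalisation. *)
Lemma cospanM_cos N g : cospan N g -> cospan N.+1 (fun t => cos t * g t).
Proof.
move=> [a ha].
apply: (@eq_cospan _ (fun t => \sum_(l < N.+1) a l * (cos t * cb l t))) => [t|].
  by rewrite ha mulr_sumr; apply: eq_bigr => l _; rewrite mulrCA.
apply: (@cospan_sum _ _ (fun l t => a l * (cos t * cb l t))) => -[|l] hl; apply: cospanZ.
  apply: eq_cospan (cospanZ (Num.sqrt (1 / pi)) (@cospan_cos N.+1 1 _)) => // t.
  by rewrite /cb /= (mul1r t) mulrC.
apply: eq_cospan (cospanZ (Num.sqrt (2 / pi) / 2)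
   (cospanD (@cospan_cos N.+1 l _) (@cospan_cos N.+1 l.+2 _))) => [t||]; try lia.
rewrite /cb /= -[l.+2%:R]natr1 (_ : l%:R * t = l.+1%:R * t - t); last first.
  by rewrite -[l.+1%:R]natr1; ring.
by rewrite (mulrDl l.+1%:R) (mul1r t) cosB cosD; field.
Qed.

Lemma cospan_poly N (P : {poly R}) : (size P <= N.+1)%N ->
  cospan N (fun t => P.[cos t]).
Proof.
move=> sP; apply: (@eq_cospan _ (fun t => \sum_(i < N.+1) P`_i * cos t ^+ i)) => [t|].
  by rewrite -horner_coef_wide.
have widen k g : (k <= N)%N -> cospan k g -> cospan N g.
  move=> kN [a ha]; apply: (@eq_cospan _ (fun t => \sum_(l < k.+1) a l * cb l t)) => [t|].
    by rewrite ha.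
  apply: (@cospan_sum _ _ (fun l t => a l * cb l t)) => l lk; apply: cospanZ.
  by apply: cospan_cb; lia.
apply: (@cospan_sum _ _ (fun i t => P`_i * cos t ^+ i)) => i iN; apply: cospanZ.
apply: (widen i) => //; elim: i {iN} => [|i IH].
  apply: eq_cospan (@cospan_cos 0 0 _) => // t; by rewrite mul0r cos0 expr0.
by apply: eq_cospan (cospanM_cos IH) => t; rewrite exprS.
Qed.

Lemma cos_poly l : exists2 P : {poly R}, (size P <= l.+1)%N &
  forall t, P.[cos t] = cos (l%:R * t).
Proof.
(* The Chebyshev recurrence has two terms, so the induction carries two consecutive degrees. *)
suff [P [Q [sP _ hP _]]] : exists P Q : {poly R}, [/\ (size P <= l.+1)%N,
    (size Q <= l.+2)%N, forall t, P.[cos t] = cos (l%:R * t) &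
    forall t, Q.[cos t] = cos (l.+1%:R * t)] by exists P.
elim: l => [|l [P [Q [sP sQ hP hQ]]]].
  exists 1, 'X; split => [||t|t]; rewrite ?size_poly1 ?size_polyX //.
  - by rewrite -polyC1 hornerC mul0r cos0.
  - by rewrite hornerX mul1r.
exists Q, ('X * Q *+ 2 - P); split => // [|t].
  rewrite (leq_trans (size_polyD _ _)) // size_polyN geq_max; apply/andP; split; last first.
    by apply: leq_trans sP _; rewrite -addn3 -addn1 leq_add2l.
  rewrite mulr2n (leq_trans (size_polyD _ _)) // maxnn.
  by apply: leq_trans (size_polyMleq _ _) _; rewrite size_polyX add2n.
rewrite hornerD hornerN hornerMn hornerM hornerX hP hQ.
rewrite -[l.+2%:R]natr1 (_ : l%:R * t = l.+1%:R * t - t); last first.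
  by rewrite -[l.+1%:R]natr1; ring.
by rewrite (mulrDl l.+1%:R) (mul1r t) cosB cosD; ring.
Qed.

Lemma cospan_is_poly N (b : nat -> R) : exists2 P : {poly R}, (size P <= N)%N &
  forall t, P.[cos t] = \sum_(l < N) b l * cb l t.
Proof.
elim: N => [|N [P sP hP]].
  by exists 0; rewrite ?size_poly0 // => t; rewrite horner0 big_ord0.
have [Q sQ hQ] := cos_poly N.
pose c : R := if N == 0%N then Num.sqrt (1 / pi) else Num.sqrt (2 / pi).
exists (P + (b N * c) *: Q) => [|t].
  rewrite (leq_trans (size_polyD _ _)) // geq_max (leq_trans sP) //=.
  exact: leq_trans (size_scale_leq _ _) sQ.
rewrite hornerD hornerZ hP hQ big_ord_recr /= -mulrA; congr (_ + _ * _).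
by rewrite /c /cb; case: eqP => // ->; rewrite mul0r cos0 mulr1.
Qed.

(** The multipliers vanish from degree n + m on. This makes the projection a competitor in E_(n+m-1)
    and also yields its measurability. *)
Lemma Sdisc_poly n m f : (0 < m < n)%N -> exists2 P : {poly R},
  (size P <= n + m)%N & forall x, -1 <= x <= 1 -> Sdisc n m f x = P.[x].
Proof.
move=> hmn; have /andP[m0 mn] := hmn.
pose b l := pi / n%:R * (\sum_(i < n) f (node R n i) * cb l (ang R n i)) * vpc R n m l.
have [P sP hP] := cospan_is_poly (n + m) b.
exists P => // x hx; rewrite -[in RHS](@acosK _ x) ?in_itv // hP Sdisc_kernel //.
transitivity (\sum_(l < 2 * n) b l * cb l (acos x)).
  under eq_bigr do rewrite mulr_sumr.
  rewrite exchange_big mulr_sumr; apply: eq_bigr => l _ /=.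
  rewrite /b -!mulrA; congr (_ * (_ * _)).
  by rewrite mulr_suml; apply: eq_bigr => i _; ring.
have -> : (2 * n = (n + m) + (n - m))%N by lia.
rewrite big_split_ord /= [X in _ + X]big1 ?addr0 // => l _.
by rewrite /b vpc_eq0 ?mulr0 ?mul0r //; lia.
Qed.

(** Degrees up to n - m < n are recovered exactly by discrete orthogonality, and there [qf] is p_r
    and [nu] is 1. *)
Lemma Sdisc_id n m (P : {poly R}) x : (0 < m < n)%N -> (size P <= (n - m).+1)%N ->
  -1 <= x <= 1 -> Sdisc n m (fun y => P.[y]) x = P.[x].
Proof.
move=> hmn sP hx; have /andP[m0 mn] := hmn; have [a ha] := cospan_poly sP.
rewrite SdiscE // -[in RHS](@acosK _ x) ?in_itv // ha.
have orth r : (r < n)%N ->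
    pi / n%:R * (\sum_(i < n) P.[node R n i] * cb r (ang R n i)) =
    \sum_(l < (n - m).+1) a l * (nat_of_ord l == r)%:R.
  move=> rn; rewrite (eq_bigr (fun i : 'I_n => \sum_(l < (n - m).+1)
     a l * (cb l (ang R n i) * cb r (ang R n i)))) => [|i _]; last first.
    by rewrite nodeE ha mulr_suml; apply: eq_bigr => l _; rewrite mulrA.
  rewrite exchange_big mulr_sumr; apply: eq_bigr => l _ /=.
  by rewrite -mulr_sumr mulrCA cb_orth //; have := ltn_ord l; lia.
rewrite (eq_bigr (fun r : 'I_n => \sum_(l < (n - m).+1)
    a l * (nat_of_ord l == r)%:R * (qf n m r x / nu R n m r))) => [|r _]; last first.
  by rewrite orth // mulr_suml.
rewrite exchange_big; apply: eq_bigr => l _ /=.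
have ln : (l < n)%N by have := ltn_ord l; lia.
rewrite (bigD1 (Ordinal ln)) //= eqxx mulr1 big1 ?addr0 => [|r]; last first.
  by rewrite -val_eqE /= eq_sym => /negbTE ->; rewrite mulr0 mul0r.
by rewrite /qf /nu chebE !ifT ?divr1 //; have := ltn_ord l; lia.
Qed.

End Proj.

(** * Marginals of the kernel majorant *)

Section Primitive.
Variable R : realType.
Implicit Types (s t u x c : R) (n m r l : nat) (f h : R -> R).

(* [h] is continuous with [\int_0^pi h = c], stated through a primitive. *)
Definition intg0pi h c := continuous h /\
  exists2 U : R -> R, forall t : R, is_derive t 1 U (h t) & U pi - U 0 = c.

Lemma intg0piD h1 h2 c1 c2 : intg0pi h1 c1 -> intg0pi h2 c2 ->
  intg0pi (fun t => h1 t + h2 t) (c1 + c2).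
Proof.
move=> [k1 [U1 d1 <-]] [k2 [U2 d2 <-]]; split.
  by move=> t; apply: cvgD; [exact: k1|exact: k2].
exists (U1 + U2); last by rewrite !fctE; ring.
by move=> t; apply: is_deriveD.
Qed.

Lemma intg0piZ h c k : intg0pi h c -> intg0pi (fun t => k * h t) (k * c).
Proof.
move=> [k1 [U d <-]]; split; first by move=> t; apply: cvgMr; exact: k1.
exists (k \*: U); last by rewrite /= /GRing.scale /= mulrBr.
by move=> t; apply: is_deriveZ.
Qed.

Lemma intg0pi_sum N (h : nat -> R -> R) (c : nat -> R) :
  (forall i, (i < N)%N -> intg0pi (h i) (c i)) ->
  intg0pi (fun t => \sum_(i < N) h i t) (\sum_(i < N) c i).
Proof.
elim: N => [_|N IH H].
  rewrite big_ord0 (_ : (fun _ => _) = cst 0); last first.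
    by apply/funext => t; rewrite big_ord0.
  split; first exact: cst_continuous.
  by exists (cst 0) => [t|]; [exact: is_derive_cst|rewrite subrr].
rewrite big_ord_recr (_ : (fun _ => _) = (fun t => \sum_(i < N) h i t + h N t)).
  by apply: intg0piD; [apply: IH => i iN; apply: H; exact: ltnW|exact: H].
by apply/funext => t; rewrite big_ord_recr.
Qed.

Lemma intg0pi_cst c : intg0pi (fun=> c) (c * pi).
Proof.
split; first exact: cst_continuous.
exists (c \*: id) => [t|]; last by rewrite /= /GRing.scale /= mulr0 subr0.
by rewrite -[X in is_derive _ _ _ X]mulr1; apply: is_deriveZ; exact: is_derive_id.
Qed.

Lemma intg0pi_cos l : intg0pi (fun t => cos (l.+1%:R * t)) 0.
Proof.
have l0 : l.+1%:R != 0 :> R by rewrite pnatr_eq0.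
split.
  move=> t; apply: (@continuous_comp _ _ _ (fun t => l.+1%:R * t) cos).
    by apply: cvgMr; exact: cvg_id.
  exact: continuous_cos.
exists (l.+1%:R^-1 \*: (sin \o (l.+1%:R \*: id))) => [t|]; last first.
  by rewrite /= /GRing.scale /= sin_natmul_pi !mulr0 sin0 mulr0 subrr.
rewrite (_ : cos _ = l.+1%:R^-1 *: (cos (l.+1%:R * t) * (l.+1%:R * 1))); last first.
  by rewrite /GRing.scale /= mulr1 (mulrC (cos _)) mulKf.
by apply: is_deriveZ; apply: is_derive1_comp.
Qed.

Lemma intg0pi_cb l s : intg0pi (fun t => cb l s * cb l t) (l == 0%N)%:R.
Proof.
case: l => [|l].
  rewrite (_ : (fun _ => _) = (fun=> pi^-1)); last by apply/funext => t; rewrite cbM0.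
  by have := intg0pi_cst pi^-1; rewrite mulVf // lt0r_neq0 // pi_gt0.
have := intg0piZ (cb l.+1 s * Num.sqrt (2 / pi)) (intg0pi_cos l).
rewrite mulr0; congr intg0pi; apply/funext => t; by rewrite /cb /= mulrA.
Qed.

(** Continuous counterpart of the node mean: only the degree 0 term of each of the r inner sums has
    a nonzero integral. *)
Lemma intg0pi_fker r s : intg0pi (fker r s) r%:R.
Proof.
have -> : r%:R = \sum_(j < r) \sum_(l < j.+1) (nat_of_ord l == 0)%N%:R :> R.
  rewrite (eq_bigr (fun=> 1)) => [|j _]; first by rewrite sumr_const card_ord.
  by rewrite big_ord_recl big1 ?addr0.
apply: (@intg0pi_sum _ (fun j t => \sum_(l < j.+1) cb l s * cb l t)
   (fun j => \sum_(l < j.+1) (nat_of_ord l == 0)%N%:R)) => j _.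
by apply: (@intg0pi_sum _ (fun l t => cb l s * cb l t) (fun l => (l == 0%N)%:R)) => l _;
  exact: intg0pi_cb.
Qed.

Lemma intg0pi_vpmaj n m s : intg0pi (vpmaj n m s) (vplam R n m).
Proof.
apply: (@intg0pi_sum _ (fun r t => `|vpc2 R n m r| * fker r.+1 s t)
   (fun r => `|vpc2 R n m r| * r.+1%:R)) => r _.
exact/intg0piZ/intg0pi_fker.
Qed.

Lemma integral_intg0pi h c : intg0pi h c -> (forall t, 0 <= h t) ->
  (\int[@lebesgue_measure R]_(x in `[(-1)%R, 1%R]) (h (acos x) * chebw x)%:E <= c%:E)%E.
Proof. by move=> [ch [U dU <-]] h0; exact: integral_acos_weight_le. Qed.

End Primitive.

(** * Jensen's inequality and the weighted p-norm bound *)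

Section Norms.
Variable R : realType.
Implicit Types (s t u x c L p M e : R) (n m r l : nat) (f : R -> R).

(** Jensen for a total mass of at most [L]. Young's inequality is applied to y_i Y^(p-1) with Y =
    (sum a_i y_i)/L; since (p-1)q = p, summation gives L Y^p <= (sum a_i y_i^p)/p + L Y^p/q. *)
Lemma powR_jensen n (a y : nat -> R) L p : 1 <= p -> 0 < L ->
  (forall i, 0 <= a i) -> (forall i, 0 <= y i) -> \sum_(i < n) a i <= L ->
  (\sum_(i < n) a i * y i) `^ p <= L `^ p / L * \sum_(i < n) a i * y i `^ p.
Proof.
move=> p1 L0 a0 y0 aL.
have p0 : 0 < p by exact: lt_le_trans p1.
have [->|pn1] := eqVneq p 1.
  (* For p = 1 the conjugate exponent is infinite, and both sides agree. *)
  rewrite (powRr1 (ltW L0)) powRr1 ?divff ?lt0r_neq0 ?mul1r //; last first.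
    by apply: sumr_ge0 => i _; rewrite mulr_ge0.
  by apply: ler_sum => i _; rewrite powRr1.
have {}p1 : 1 < p by rewrite lt_neqAle eq_sym pn1.
pose q := p / (p - 1).
have q0 : 0 < q by rewrite divr_gt0 // subr_gt0.
have pq : p^-1 + q^-1 = 1.
  by rewrite /q invf_div -{1}(div1r p) -mulrDl subrKC mulfV // gt_eqF.
pose Y := (\sum_(i < n) a i * y i) / L.
have Y0 : 0 <= Y by rewrite divr_ge0 ?(ltW L0) // sumr_ge0 // => i _; rewrite mulr_ge0.
have young i : a i * (y i * Y `^ (p - 1)) <= a i * (y i `^ p / p + Y `^ p / q).
  apply: ler_wpM2l => //; apply: le_trans (conjugate_powR (y0 i) _ p0 q0 pq) _.
    exact: powR_ge0.
  by rewrite -powRrM /q mulrCA mulfV ?mulr1 // gt_eqF // subr_gt0.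
have key : L * Y `^ p <= \sum_(i < n) a i * y i `^ p.
  have : \sum_(i < n) a i * (y i * Y `^ (p - 1)) <=
         \sum_(i < n) a i * (y i `^ p / p + Y `^ p / q) by apply: ler_sum => i _.
  under eq_bigr do rewrite mulrA.
  under [X in _ <= X -> _]eq_bigr do rewrite mulrDr (mulrA _ (_ `^ p)).
  rewrite big_split /= -!mulr_suml.
  have -> : \sum_(i < n) a i * y i = L * Y by rewrite /Y mulrCA mulfV ?mulr1 ?gt_eqF.
  rewrite -mulrA mulr_powRB1 // => h1.
  have h2 : (\sum_(i < n) a i) * (Y `^ p / q) <= L * (Y `^ p / q).
    by rewrite ler_wpM2r // divr_ge0 ?powR_ge0 // ltW.
  have e1 : L * Y `^ p = L * Y `^ p / p + L * (Y `^ p / q).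
    by rewrite mulrA -mulrDr pq mulr1.
  rewrite -(ler_pM2r (_ : 0 < p^-1)) ?invr_gt0 //; lra.
have -> : \sum_(i < n) a i * y i = L * Y by rewrite /Y mulrCA mulfV ?mulr1 ?gt_eqF.
rewrite powRM ?(ltW L0) // -mulrA ler_wpM2l ?powR_ge0 //.
by rewrite -(ler_pM2l L0) mulrA mulfV ?mul1r ?gt_eqF.
Qed.

(** The node marginal of the majorant allows Jensen at each x; the integral marginal then bounds the
    integral of the result. *)
Lemma normp_Sdisc_le n m f L p : (0 < m < n)%N -> 1 <= p -> 0 < L ->
  vplam R n m <= L -> normp p%:E (Sdisc n m f) <= L * dnormp p%:E n f.
Proof.
move=> hmn p1 L0 lamL; have /andP[m0 mn] := hmn.
have n0 : (0 < n)%N by lia.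
have p0 : 0 < p by exact: lt_le_trans p1.
have pn0 : 0 <= pi / n%:R :> R by rewrite divr_ge0 ?pi_ge0.
rewrite /normp /dnormp; set D := pi / n%:R * _.
have D0 : 0 <= D by rewrite mulr_ge0 // sumr_ge0 // => i _; exact: powR_ge0.
pose h t := L `^ p / L * (\sum_(i < n) (pi / n%:R * `|f (node R n i)| `^ p) *
  vpmaj n m (ang R n i) t).
have h0 t : 0 <= h t.
  rewrite mulr_ge0 ?divr_ge0 ?powR_ge0 ?(ltW L0) //; apply: sumr_ge0 => i _.
  by rewrite mulr_ge0 ?vpmaj_ge0 // mulr_ge0 ?powR_ge0.
have hint : intg0pi h (L `^ p / L * (\sum_(i < n)
    (pi / n%:R * `|f (node R n i)| `^ p) * vplam R n m)).
  apply: intg0piZ; apply: (@intg0pi_sum _ _ (fun i t =>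
    (pi / n%:R * `|f (node R n i)| `^ p) * vpmaj n m (ang R n i) t)
    (fun i => (pi / n%:R * `|f (node R n i)| `^ p) * vplam R n m)) => i _.
  exact/intg0piZ/intg0pi_vpmaj.
have Sh x : `|Sdisc n m f x| `^ p <= h (acos x).
  have := Sdisc_norm_le f x hmn; rewrite mulr_sumr => Sle.
  pose a i := pi / n%:R * vpmaj n m (ang R n i) (acos x).
  have a0 i : 0 <= a i by rewrite mulr_ge0 ?vpmaj_ge0.
  have aL : \sum_(i < n) a i <= L by rewrite -mulr_sumr sum_vpmaj.
  apply: le_trans (le_trans (powR_jensen p1 L0 a0 (fun i => normr_ge0 (f (node R n i))) aL) _).
    rewrite ge0_ler_powR ?nnegrE ?(ltW p0) //.
      by apply: sumr_ge0 => i _; rewrite mulr_ge0.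
    by apply: le_trans Sle _; apply: ler_sum => i _; rewrite /a mulrCA mulrC.
  rewrite /h ler_wpM2l ?divr_ge0 ?powR_ge0 ?(ltW L0) //; apply: ler_sum => i _.
  by rewrite /a -!mulrA [vpmaj _ _ _ _ * _]mulrC.
have Ih := integral_intg0pi hint h0.
have IS : (\int[@lebesgue_measure R]_(x in `[(-1)%R, 1%R])
    ((`|Sdisc n m f x| `^ p) * chebw x)%:E <= (L `^ p * D)%:E)%E.
  (* Measurability of the projection is read off its polynomial form. *)
  have [P _ hP] := Sdisc_poly f hmn.
  have w0 x : 0 <= chebw x :> R by rewrite invr_ge0 sqrtr_ge0.
  have mw : measurable_fun (`](-1)%R, 1%R[%classic : set R) (@chebw R).
    apply: open_continuous_measurable_fun => // x.
    by rewrite inE /= in_itv /= => hx; exact: chebw_continuous.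
  have mS : measurable_fun (`[(-1)%R, 1%R]%classic : set R)
      (fun x => (`|Sdisc n m f x| `^ p) * chebw x).
    apply/measurable_fun_itv_bndo_bndcP/measurable_fun_itv_obnd_cbndP.
    apply: measurable_funM => //.
    apply: (@eq_measurable_fun _ _ _ _ _ (fun x => `|P.[x]| `^ p)) => [x|].
      by rewrite inE /= in_itv /= => /andP[x1 x2]; rewrite hP // !ltW.
    apply: (measurableT_comp (measurable_powR p)).
    by apply: measurableT_comp => //; exact: measurable_poly.
  apply: (@le_trans _ _ (\int[@lebesgue_measure R]_(x in `[(-1)%R, 1%R])
    (h (acos x) * chebw x)%:E)%E).
    apply: ge0_le_integral => //.
    - by move=> x _; rewrite lee_fin mulr_ge0 ?powR_ge0.
    - exact/measurable_EFinP.
    - apply/measurable_EFinP/measurable_fun_itv_bndo_bndcP/measurable_fun_itv_obnd_cbndP.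
      by apply: measurable_acos_weight; case: hint.
    - by move=> x _; rewrite lee_fin ler_wpM2r.
  (* The integral marginal, at most [L], absorbs the factor 1/L left by Jensen. *)
  apply: le_trans Ih _; rewrite lee_fin -mulr_suml -mulr_sumr -/D.
  rewrite -mulrA ler_wpM2l ?powR_ge0 // mulrCA ler_piMr //.
  by rewrite mulrC ler_pdivrMr ?mul1r.
have I0 : (0 <= \int[@lebesgue_measure R]_(x in `[(-1)%R, 1%R])
    ((`|Sdisc n m f x| `^ p) * chebw x)%:E)%E.
  apply: integral_ge0 => x _.
  by rewrite lee_fin mulr_ge0 ?powR_ge0 // invr_ge0 sqrtr_ge0.
suff : fine (\int[@lebesgue_measure R]_(x in `[(-1)%R, 1%R])
    ((`|Sdisc n m f x| `^ p) * chebw x)%:E) `^ p^-1 <= (L `^ p * D) `^ p^-1.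
  by rewrite powRM ?powR_ge0 // -powRrM mulfV ?powRr1 ?(ltW L0) ?lt0r_neq0.
apply: ge0_ler_powR.
- by rewrite invr_ge0 ltW.
- by rewrite nnegrE; apply: fine_ge0; exact: I0.
- by rewrite nnegrE mulr_ge0 ?powR_ge0.
(* The integral is finite, so [fine] preserves the inequality. *)
rewrite -[leRHS]/(fine (L `^ p * D)%:E) fine_le //.
by rewrite ge0_fin_numE // (le_lt_trans IS) ?ltry.
Qed.

End Norms.

(** * Discrete Fejer means and Weierstrass' theorem *)

Section Weierstrass.
Variable R : realType.
Implicit Types (s t u x y d c L p M e : R) (n m r l : nat) (f : R -> R).

(** Uniform continuity handles |x - y| < d; otherwise 2M <= (2M/d^2)(x - y)^2. In this form a
    positive mean is controlled by its second moment. *)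
Lemma within_itv_quad_modulus f e : {within `[-1, 1], continuous f} -> 0 < e ->
  exists2 K : R, 0 <= K & forall x y, -1 <= x <= 1 -> -1 <= y <= 1 ->
    `|f x - f y| <= e + K * (x - y) ^+ 2.
Proof.
move=> cf e0; pose A : set R := `[-1, 1]%classic.
have cA : compact A by exact: segment_compact.
have [M M0 fM] : exists2 M : R, 0 <= M & forall x, -1 <= x <= 1 -> `|f x| <= M.
  have cnf : {within `[-1, 1], continuous (fun x => `|f x|)}.
    by move=> x; apply: continuous_comp; [exact: cf|exact: norm_continuous].
  have [|c _ hc] := @EVT_max R (fun x => `|f x|) (-1) 1 _ cnf; first by lra.
  by exists `|f c| => // x hx; apply: hc; rewrite in_itv.
have [d d0 hd] : exists2 d : R, 0 < d & forall x y, -1 <= x <= 1 -> -1 <= y <= 1 ->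
    `|x - y| < d -> `|f x - f y| <= e.
  pose P d x := forall y, A y -> `|x - y| < d -> `|f x - f y| <= e.
  have Pnear : \forall d \near 0^'+, A `<=` P d.
    have /compact_near_coveringP/near_covering_withinP nc := cA.
    apply: nc => x Ax.
    have /subspace_continuousP /(_ x Ax) /cvgrPdist_lt /(_ (e / 2)) := cf.
    rewrite divr_gt0 // => /(_ isT) /nbhs_ballP [k /= k0 hk].
    have near_x z : A z -> `|x - z| < k -> `|f x - f z| < e / 2.
      by move=> Az xz; apply: hk.
    (* Halving the radius keeps both x' and every y with |x' - y| < d within k of x. *)
    exists (ball x (k / 2), [set d | d < k / 2]) => /=.
      split; first by apply: nbhsx_ballx; rewrite divr_gt0.
      by apply: nbhs_right_lt; rewrite divr_gt0.
    move=> [x' d] [/= bx dk] Ax' y Ay x'y.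
    have bx' : `|x - x'| < k / 2 by [].
    have h1 : `|f x - f x'| < e / 2 by apply: near_x => //; lra.
    have h2 : `|f x - f y| < e / 2.
      apply: near_x => //; apply: le_lt_trans (ler_distD x' _ _) _; lra.
    by apply: le_trans (ler_distD (f x) _ _) _; rewrite (distrC (f x')); lra.
  have [d [hd d0]] : exists d : R, A `<=` P d /\ 0 < d.
    apply: (@filter_ex _ ((0 : R)^'+)).
    by apply: filterI => //; exact: nbhs_right_gt.
  by exists d => // x y hx hy; apply: hd; rewrite /A /= in_itv.
exists (2 * M / d ^+ 2) => [|x y hx hy].
  by rewrite divr_ge0 ?mulr_ge0 ?exprn_ge0 // ltW.
have [xyd|xyd] := ltP `|x - y| d.
  apply: le_trans (hd _ _ hx hy xyd) _.
  by rewrite lerDl mulr_ge0 ?sqr_ge0 // divr_ge0 ?mulr_ge0 ?exprn_ge0 // ltW.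
apply: (@le_trans _ _ (2 * M)).
  by apply: le_trans (ler_normB _ _) _; rewrite mulr2n mulrDl mul1r lerD ?fM.
apply: ler_wpDl; first exact: ltW.
rewrite mulrAC ler_pdivlMr ?exprn_gt0 // ler_wpM2l ?mulr_ge0 //.
by rewrite -[leRHS]real_normK ?num_real // lerXn2r ?nnegrE ?(ltW d0).
Qed.

(** Degree l occurs in exactly r - l of the partial sums, whence the triangular Fejer weights. *)
Lemma fkerS r s t :
  fker r s t = \sum_(l < r) (r - l)%:R * (cb l s * cb l t) :> R.
Proof.
elim: r => [|r IH]; first by rewrite /fker !big_ord0.
rewrite /fker big_ord_recr -/(fker r s t) IH /= [in RHS]big_ord_recr /=.
rewrite [X in _ + X = _]big_ord_recr /= addrA -big_split /=; congr (_ + _).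
  apply: eq_bigr => l _; rewrite -[X in _ + X]mul1r -mulrDl natr1.
  by congr (_%:R * _); have := ltn_ord l; lia.
by rewrite subSnn mul1r.
Qed.

Lemma sum_cb_fker n l t : (l < n)%N ->
  pi / n%:R * (\sum_(i < n) cb l (ang R n i) * fker n (ang R n i) t) =
  (n - l)%:R * cb l t.
Proof.
move=> ln; rewrite (eq_bigr (fun i : 'I_n => \sum_(k < n)
   (n - k)%:R * cb k t * (cb l (ang R n i) * cb k (ang R n i)))) => [|i _]; last first.
  by rewrite fkerS mulr_sumr; apply: eq_bigr => k _; ring.
rewrite exchange_big mulr_sumr /= (bigD1 (Ordinal ln)) //= [X in _ + X]big1 => [|k].
  by rewrite -mulr_sumr mulrCA cb_orth // eqxx mulr1 addr0.
rewrite -val_eqE /= => kl; rewrite -mulr_sumr mulrCA cb_orth //.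
by rewrite eq_sym (negbTE kl) mulr0.
Qed.

Lemma sum_cos_fker n l t : (0 < l < n)%N ->
  pi / n%:R * (\sum_(i < n) cos (l%:R * ang R n i) * fker n (ang R n i) t) =
  (n - l)%:R * cos (l%:R * t).
Proof.
case: l => // l ln; have c0 : Num.sqrt (2 / pi) != 0 :> R.
  by rewrite sqrtr_eq0 -ltNge divr_gt0 ?pi_gt0.
apply: (mulfI c0); rewrite mulrCA mulr_sumr [RHS]mulrCA -(sum_cb_fker t ln).
by congr (_ * _); apply: eq_bigr => i _; rewrite mulrA.
Qed.

(** (cos s - cos t)^2 has degree 2 < n in s, and degree l is multiplied by n - l; the cos^2 t terms
    cancel and the constants leave 1. *)
Lemma fejer_moment2 n t : (2 < n)%N ->
  pi / n%:R * (\sum_(i < n) (cos (ang R n i) - cos t) ^+ 2 * fker n (ang R n i) t) = 1.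
Proof.
move=> n2; have c2 u : cos (2%:R * u) = cos u ^+ 2 *+ 2 - 1.
  by rewrite mulr_natl cos_mulr2n.
have -> : \sum_(i < n) (cos (ang R n i) - cos t) ^+ 2 * fker n (ang R n i) t =
    2^-1 * (\sum_(i < n) cos (2%:R * ang R n i) * fker n (ang R n i) t)
    - (cos t *+ 2) * (\sum_(i < n) cos (1%:R * ang R n i) * fker n (ang R n i) t)
    + (2^-1 + cos t ^+ 2) * (\sum_(i < n) fker n (ang R n i) t).
  rewrite !mulr_sumr -sumrB -big_split; apply: eq_bigr => i _ /=.
  by rewrite c2 (mul1r (ang R n i)); field.
rewrite mulrDr mulrBr ![pi / _ * (_ * _)]mulrCA !sum_cos_fker ?sum_fker_node; try lia.
rewrite c2 (mul1r t) !natrB; try lia.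
by field.
Qed.

Lemma weierstrass_itv f e : {within `[-1, 1], continuous f} -> 0 < e ->
  exists P : {poly R}, forall x, -1 <= x <= 1 -> `|f x - P.[x]| <= e.
Proof.
move=> cf e0; have e2 : 0 < e / 2 by rewrite divr_gt0.
have [K K0 hK] := within_itv_quad_modulus cf e2.
have [n n2 nK] : exists2 n, (2 < n)%N & K / n%:R <= e / 2.
  (* The threshold gives K/n <= e/2, and the [.+3] ensures 2 < n for the second moment. *)
  exists (Num.truncn (K * 2 / e)).+3 => //; set n := _.+3.
  have : K * 2 / e <= n%:R.
    apply: le_trans (ltW (truncnS_gt _)) _; rewrite ler_nat.
    by apply: leqW; exact: leqnSn.
  by rewrite ler_pdivrMr // ler_pdivrMr ?ltr0n // => h; lra.
(* Coefficients of the discrete Fejer mean of f: discrete Chebyshev coefficients times the weights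
   (n - l)/n. *)
pose b l := pi / n%:R * (\sum_(i < n) f (node R n i) * cb l (ang R n i)) *
  ((n - l)%:R / n%:R).
have [P _ hP] := cospan_is_poly n b.
exists P => x hx; set t := acos x; have xt : x = cos t by rewrite /t acosK // in_itv.
have n0 : (0 < n%:R :> R) by rewrite ltr0n; lia.
pose w i := pi / n%:R * fker n (ang R n i) t / n%:R.
have w0 i : 0 <= w i.
  by rewrite divr_ge0 ?ler0n // mulr_ge0 ?fker_ge0 // divr_ge0 ?pi_ge0.
have w1 : \sum_(i < n) w i = 1.
  by rewrite -mulr_suml -mulr_sumr sum_fker_node ?divff ?lt0r_neq0 //; lia.
have w2 : \sum_(i < n) w i * (x - node R n i) ^+ 2 = n%:R^-1.
  rewrite -[RHS]mul1r -[X in _ = X * _](@fejer_moment2 n t) // mulr_sumr mulr_suml.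
  by apply: eq_bigr => i _; rewrite /w nodeE xt; ring.
have PE : P.[x] = \sum_(i < n) w i * f (node R n i).
  rewrite xt hP; transitivity (\sum_(l < n) \sum_(i < n)
     pi / n%:R / n%:R * f (node R n i) * ((n - l)%:R * (cb l (ang R n i) * cb l t))).
    apply: eq_bigr => l _; rewrite /b mulr_sumr !mulr_suml.
    by apply: eq_bigr => i _; ring.
  rewrite exchange_big; apply: eq_bigr => i _ /=.
  by rewrite -mulr_sumr -fkerS /w; ring.
have -> : f x - P.[x] = \sum_(i < n) w i * (f x - f (node R n i)).
  under eq_bigr do rewrite mulrBr.
  by rewrite sumrB -mulr_suml w1 mul1r PE.
apply: le_trans (ler_norm_sum _ _ _) _.
apply: (@le_trans _ _ (\sum_(i < n) w i * (e / 2 + K * (x - node R n i) ^+ 2))).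
  apply: ler_sum => i _; rewrite normrM ger0_norm //; apply: ler_wpM2l => //.
  by apply: hK => //; rewrite nodeE cos_geN1 cos_le1.
under eq_bigr do rewrite mulrDr (mulrCA _ K).
rewrite big_split /= -mulr_suml w1 mul1r -mulr_sumr w2; lra.
Qed.

End Weierstrass.

(** * Error estimates *)

Section Final.
Variable R : realType.
Implicit Types (s t u x y c L p M e theta : R) (n m r l : nat) (f : R -> R).

Lemma supnorm_le f M : (forall x, -1 <= x <= 1 -> `|f x| <= M) -> supnorm f <= M.
Proof.
move=> h; apply: ge_sup; first by exists `|f 0|, 0 => //=; rewrite in_itv /=; lra.
by move=> _ [x + <-]; rewrite /= in_itv; exact: h.
Qed.

Lemma supnorm_ge0 f : 0 <= supnorm f.
Proof.
have [hs|hs] := pselect (has_sup [set `|f x| | x in `[-1, 1]%classic]).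
  apply: le_trans (normr_ge0 (f 0)) _; apply: (sup_upper_bound hs).
  by exists 0 => //=; rewrite in_itv /=; lra.
(* For an unbounded function [sup] takes its default value 0. *)
by rewrite /supnorm sup_out.
Qed.

Lemma within_itv_bounded f : {within `[-1, 1], continuous f} ->
  exists M, forall x, -1 <= x <= 1 -> `|f x| <= M.
Proof.
move=> /within_itv_quad_modulus /(_ ltr01) [K K0 hK].
exists (`|f 0| + (1 + K)) => x hx; rewrite -lerBlDl.
apply: le_trans (lerB_dist _ _) _; apply: le_trans (hK _ _ hx _) _; first by lra.
by rewrite subr0 lerD2l ler_piMr //; nra.
Qed.

(** Continuity bounds the set of values, so that its [sup] is a true upper bound. *)
Lemma ler_supnormB_poly f (P : {poly R}) : {within `[-1, 1], continuous f} ->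
  forall x, -1 <= x <= 1 -> `|f x - P.[x]| <= supnorm (fun x => f x - P.[x]).
Proof.
move=> cf x hx; apply: ub_le_sup; last by exists x => //=; rewrite in_itv.
have [M hM] := within_itv_bounded cf.
have [|N hN] := @within_itv_bounded (horner P).
  by apply: continuous_subspaceT; exact: continuous_horner.
exists (M + N) => _ [y + <-]; rewrite /= in_itv /= => hy.
by apply: le_trans (ler_normB _ _) _; rewrite lerD ?hM ?hN.
Qed.

(** As m >= 1, theta n < m + 1 <= 2m; and m <= theta n < n. *)
Lemma truncn_ratio theta n : 0 < theta < 1 ->
  let m := Num.truncn (theta * n%:R) in (0 < m)%N ->
  (m < n)%N /\ n%:R / m%:R <= 2 / theta.
Proof.
move=> /andP[t0 t1] m m0; have n0 : (0 < n)%N.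
  by move: m0; rewrite /m; case: n {m} => //; rewrite mulr0 truncn0.
have nn : 0 < n%:R :> R by rewrite ltr0n.
have /truncn_itv /andP[m1 m2] : 0 <= theta * n%:R by rewrite mulr_ge0 ?ltW.
split; first by rewrite -(ltr_nat R); apply: le_lt_trans m1 _; rewrite gtr_pMl.
rewrite ler_pdivrMr ?ltr0n // mulrAC ler_pdivlMr // mulrC.
apply: le_trans (ltW m2) _; rewrite -natrM ler_nat -/m; lia.
Qed.

Definition vpbound theta : R := (2 / theta) ^+ 2 * 64 + (2 / theta) * 16.

Lemma vplam_bound theta n : 0 < theta < 1 ->
  let m := Num.truncn (theta * n%:R) in (0 < m)%N ->
  (0 < m < n)%N /\ vplam R n m <= vpbound theta.
Proof.
move=> ht m m0; have [mn q] := @truncn_ratio theta n ht m0.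
have hmn : (0 < m < n)%N by rewrite m0.
have q0 : 0 <= n%:R / m%:R :> R by rewrite divr_ge0.
split=> //; apply: le_trans (vplam_le R hmn) _.
by rewrite lerD // ler_wpM2r // lerXn2r ?nnegrE // (le_trans q0).
Qed.

(** Lebesgue's argument: Sf - f = S(f - P) - (f - P), as S reproduces P. *)
Lemma Sdisc_error n m f (P : {poly R}) M : (0 < m < n)%N -> (size P <= (n - m).+1)%N ->
  (forall x, -1 <= x <= 1 -> `|f x - P.[x]| <= M) ->
  forall x, -1 <= x <= 1 -> `|Sdisc n m f x - f x| <= (vplam R n m + 1) * M.
Proof.
move=> hmn sP hM x hx.
have -> : Sdisc n m f x - f x = Sdisc n m (fun y => f y - P.[y]) x - (f x - P.[x]).
  by rewrite SdiscB (Sdisc_id hmn sP hx); ring.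
apply: le_trans (ler_normB _ _) _; rewrite mulrDl mul1r lerD ?hM //.
by apply: Sdisc_sup_le => // i _; rewrite hM // nodeE cos_geN1 cos_le1.
Qed.

End Final.

Theorem theorem3 (R : realType) (theta : R) :
  0 < theta < 1 ->
  (forall p : \bar R, (1 <= p)%E ->
     exists C : R, 0 < C /\
       forall (n : nat) (f : R -> R),
         let m := Num.truncn (theta * n%:R) in
         (0 < m)%N ->
         normp p (Sdisc n m f) <= C * dnormp p n f) /\
  (forall f : R -> R, {within `[-1, 1], continuous f} ->
     forall e : R, 0 < e -> exists N : nat, forall n : nat, (N <= n)%N ->
       forall x : R, x \in `[-1, 1] ->
         `|Sdisc n (Num.truncn (theta * n%:R)) f x - f x| < e) /\
  (exists C : R, 0 < C /\
     forall (f : R -> R), {within `[-1, 1], continuous f} ->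
     forall n : nat,
       let m := Num.truncn (theta * n%:R) in
       (0 < m)%N ->
       EN (n + m - 1) f <= supnorm (fun x => Sdisc n m f x - f x) /\
       supnorm (fun x => Sdisc n m f x - f x) <= C * EN (n - m) f).
Proof.
move=> ht; have /andP[t0 t1] := ht; set L := vpbound theta.
have q0 : 0 < 2 / theta by rewrite divr_gt0.
have L0 : 0 < L by rewrite addr_gt0 // mulr_gt0 // exprn_gt0.
have L1 : 0 < L + 1 by rewrite ltr_wpDl ?ltW.
split; last split.
- case=> [p||] // p1; exists L; split=> // n f m m0;
    have [hmn lamL] := vplam_bound ht m0; first exact: normp_Sdisc_le.
  (* The case p = +oo: the node values are bounded by their maximum. *)
  apply: supnorm_le => x _.
  pose M := \big[Num.max/0]_(i < n) `|f (node R n i)|.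
  apply: (@le_trans _ _ (vplam R n m * M)).
    apply: Sdisc_sup_le => // i hi.
    exact: (le_bigmax _ (fun i : 'I_n => `|f (node R n i)|) (Ordinal hi)).
  apply: ler_wpM2r => //; exact: bigmax_ge_id.
(* The half makes the final bound strict: (L + 1) d = e/2. *)
- move=> f cf e e0; pose d := e / (L + 1) / 2.
  have [|P hP] := @weierstrass_itv R f d cf; first by rewrite !divr_gt0.
  (* [N1] forces theta n >= 1, hence m >= 1; [N2] forces size P <= (1 - theta) n <= n - m. *)
  pose N1 := (Num.truncn theta^-1).+1.
  pose N2 := (Num.truncn ((size P)%:R / (1 - theta))).+1.
  exists (N1 + N2)%N => n Nn x; rewrite in_itv /= => hx; set m := Num.truncn _.
  have n1 : theta^-1 < n%:R.
    by apply: lt_le_trans (truncnS_gt _) _; rewrite ler_nat (leq_trans _ Nn) // leq_addr.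
  have m0 : (0 < m)%N by rewrite truncn_gt0 mulrC -ler_pdivrMr // div1r ltW.
  have [hmn lamL] := vplam_bound ht m0; have /andP[_ mn] := hmn.
  have sP : (size P <= (n - m).+1)%N.
    rewrite -(ler_nat R) -natr1 natrB 1?ltnW //.
    have n2 : (size P)%:R / (1 - theta) < n%:R.
      by apply: lt_le_trans (truncnS_gt _) _; rewrite ler_nat (leq_trans _ Nn) // leq_addl.
    move: n2; rewrite ltr_pdivrMr ?subr_gt0 // => n2.
    have : m%:R <= theta * n%:R by rewrite truncn_le mulr_ge0 // ltW.
    lra.
  apply: le_lt_trans (Sdisc_error hmn sP hP hx) _.
  apply: (@le_lt_trans _ _ ((L + 1) * d)).
    by rewrite ler_wpM2r ?lerD // !divr_ge0 // ltW.
  by rewrite /d mulrA mulrCA mulfV ?gt_eqF // mulr1; lra.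
exists (L + 1); split=> //.
move=> f cf n m m0; have [hmn lamL] := vplam_bound ht m0; have /andP[_ mn] := hmn.
split.
  have [P sP hP] := Sdisc_poly f hmn.
  apply: (@le_trans _ _ (supnorm (fun x => f x - P.[x]))).
    (* The distances are bounded below by 0, so [inf] lies below the one attained by the
       projection. *)
    apply: ge_inf; first by exists 0 => _ [Q _ <-]; exact: supnorm_ge0.
    by exists P => //=; rewrite subn1 prednK // addn_gt0 m0 orbT.
  rewrite le_eqVlt; apply/orP; left; apply/eqP; congr sup.
  apply/seteqP; split=> _ [x hx <-]; exists x => //; move: hx; rewrite /= in_itv /= => hx;
    by rewrite hP // distrC.
(* Divided by L + 1, the error is a lower bound of all the distances; the zero polynomial shows that
   the set is nonempty. *)
rewrite [leRHS]mulrC -ler_pdivrMr //; apply: lb_le_inf.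
  by exists (supnorm (fun x => f x - (0 : {poly R}).[x])), 0 => //=; rewrite size_poly0.
move=> _ [P /= sP <-]; rewrite ler_pdivrMr //.
apply: supnorm_le => x hx.
apply: le_trans (Sdisc_error hmn sP (ler_supnormB_poly P cf) hx) _.
by rewrite [leRHS]mulrC ler_wpM2r ?supnorm_ge0 // lerD.
Qed.
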